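(* Let $\tau$ be the Takagi function and let $\Gamma_H^{ord}$ be the set of ordinates $y\in[0,\frac23]$ such that the level set $L(y)$ has positive Hausdorff dimension, i.e. $$\Gamma_H^{ord}:=\{y\in[0,\tfrac23]:\ \dim_H(L(y))>0\}.$$ Then $\Gamma_H^{ord}$ has full Hausdorff dimension, i.e. $\dim_H(\Gamma_H^{ord})=1$.
   Context: The Takagi function is $\tau(x)=\sum_{n=0}^\infty \frac{\ll 2^n x\gg}{2^n}$ for $x\in[0,1]$, where $\ll t\gg$ denotes the distance from $t$ to the nearest integer. It satisfies $0\le\tau(x)\le\frac23$. For $0\le y\le\frac23$ the level set is $L(y)=\{x\in[0,1]:\tau(x)=y\}$. $\dim_H$ denotes Hausdorff dimension of subsets of $\mathbb{R}$. *)

(* Defs.v *)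
From HB Require Import structures.
From mathcomp Require Import all_boot all_order all_algebra.
From mathcomp Require Import all_classical all_reals all_analysis.

Set Implicit Arguments.
Unset Strict Implicit.
Unset Printing Implicit Defensive.

Import Order.TTheory GRing.Theory Num.Theory.
Import numFieldNormedType.Exports.

Local Open Scope classical_set_scope.
Local Open Scope ring_scope.

Definition dist_nearest_int (R : realType) (t : R) : R :=
  inf [set `|t - m%:~R| | m in [set: int]].

Definition takagi (R : realType) (x : R) : R :=
  limn (series (fun n => dist_nearest_int (2 ^+ n * x) / 2 ^+ n)).

Definition takagi_level_set (R : realType) (y : R) : set R :=
  [set x | 0 <= x <= 1 /\ takagi x = y].

(* The diameter of the empty set is -oo here; [hausdorff_weight] treats it
   separately. *)
Definition diameter (R : realType) (A : set R) : \bar R :=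
  ereal_sup [set `|x - y|%:E | x in A & y in A].

(* [(diam A)^s] with the usual conventions: the empty set has weight 0 for
   every [s], and a nonempty set has weight 1 for [s = 0] (as [poweRe0] gives
   [0 `^ 0 = 1]), so that the 0-dimensional measure is the counting measure. *)
Definition hausdorff_weight (R : realType) (s : R) (A : set R) : \bar R :=
  if A == set0 then 0%E else (diameter A `^ s)%E.

Definition hausdorff_premeasure (R : realType) (s delta : R) (A : set R) :
    \bar R :=
  ereal_inf [set (\sum_(0 <= i <oo) hausdorff_weight s (U i))%E |
    U in [set U : (set R)^nat | A `<=` \bigcup_i U i /\
                                forall i, (diameter (U i) <= delta%:E)%E]].

Definition hausdorff_measure (R : realType) (s : R) (A : set R) : \bar R :=
  ereal_sup [set hausdorff_premeasure s delta A |
    delta in [set delta : R | 0 < delta]].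

Definition hausdorff_dim (R : realType) (A : set R) : \bar R :=
  ereal_inf [set s%:E |
    s in [set s : R | 0 <= s /\ hausdorff_measure s A = 0%E]].

Definition Gamma_H_ord (R : realType) : set R :=
  [set y : R | 0 <= y <= 2 / 3 /\
               (0 < hausdorff_dim (takagi_level_set y))%E].

(* Main.v *)
Require Import Defs.
From mathcomp Require Import all_boot all_order all_algebra.
From mathcomp Require Import all_classical all_reals all_analysis.
From mathcomp Require Import zify ring lra.

(** On the dyadic interval [B/2^n, (B+1)/2^n] the graph of the Takagi function is a
    copy of the whole graph scaled by 2^-n and sheared by the integer slope D_n(B)
    (zeros minus ones among the n binary digits of B).  When D_n(B) = 0 there is no
    shear, so a point whose base-2^N digits B_0, B_1, ... are all balanced is sent to
    the point with base-2^N digits c(B_k), where c(B) = 2^N tau(B/2^N) is an integer.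

    Replacing any digit B_k by its complement does not change c(B_k), so such a value
    has a level set containing a Cantor set of dimension 1/N.

    It remains to find balanced words with many different c.  The walk
    B |-> 2^n tau(B/2^n) climbs from 0 to 2^(n-1) with steps D_n(B), and by a fourth
    moment estimate the steps larger than K = n/k cover at most half of that range
    when n = 12 k^3.  So some slope d <= K carries at least 2^n/(4K^2) values;
    appending d ones makes these words balanced without merging their values.  As
    k grows, the resulting self-similar sets of ordinates have dimension tending to 1.

    A Cantor set given by M digits in base b is mapped onto [0,1[ by reading the
    digit indices in base M, and this map is Hoelder of exponent s when b^s <= M, so
    Lebesgue measure bounds any cover from below. *)

Set Implicit Arguments.
Unset Strict Implicit.
Unset Printing Implicit Defensive.

Import Order.TTheory GRing.Theory Num.Theory.
Import numFieldNormedType.Exports.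

(** * Takagi values at dyadic points *)

(* [tak n B] is [2 ^ n * takagi (B / 2 ^ n)] for [B <= 2 ^ n], read off the leading
   binary digit of [B]; [slope n B] is the deficient digit function D_n. *)
Fixpoint tak (n B : nat) : nat :=
  if n is m.+1 then
    if B < 2 ^ m then tak m B + B else tak m (B - 2 ^ m) + (2 ^ m - (B - 2 ^ m))
  else 0.

Fixpoint slope (n B : nat) : int :=
  if n is m.+1 then
    if B < 2 ^ m then (slope m B + 1)%R else (slope m (B - 2 ^ m) - 1)%R
  else 0%R.

Lemma tak_pow2 n : tak n (2 ^ n) = 0.
Proof.
elim: n => [//|n IH] /=; rewrite expnS mul2n -addnn ltnNge leq_addr /=.
by rewrite addnK IH subnn.
Qed.

Lemma tak0 n : tak n 0 = 0.
Proof. by elim: n => [//|n IH] /=; rewrite expn_gt0 /= IH. Qed.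

(** At [B = 2 ^ n] the definition takes its other branch; both formulas give [2 ^ n] there, as
    [tak n] vanishes at both ends. The closed range lets [tak_succ] reach the midpoint. *)
Lemma takS_lo n B : B <= 2 ^ n -> tak n.+1 B = tak n B + B.
Proof.
rewrite /= leq_eqVlt => /predU1P[->|->//].
by rewrite ltnn subnn tak0 tak_pow2 subn0.
Qed.

Lemma takS_hi n B : tak n.+1 (2 ^ n + B) = tak n B + (2 ^ n - B).
Proof. by rewrite /= ltnNge leq_addr /= addKn. Qed.

Lemma slopeS_lo n B : B < 2 ^ n -> slope n.+1 B = (slope n B + 1)%R.
Proof. by rewrite /= => ->. Qed.

Lemma slopeS_hi n B : slope n.+1 (2 ^ n + B) = (slope n B - 1)%R.
Proof. by rewrite /= ltnNge leq_addr /= addKn. Qed.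

Lemma ltn_pow2S_ind n (P : nat -> Prop) :
  (forall B, B < 2 ^ n -> P B) -> (forall B, B < 2 ^ n -> P (2 ^ n + B)) ->
  forall B, B < 2 ^ n.+1 -> P B.
Proof.
move=> Plo Phi B; rewrite expnS => ltB; case: (ltnP B (2 ^ n)) => [/Plo//|leB].
by rewrite -(subnKC leB); apply: Phi; lia.
Qed.

Lemma tak_succ n B : B < 2 ^ n ->
  ((tak n B.+1)%:Z = (tak n B)%:Z + slope n B)%R.
Proof.
elim: n B => [|n IH]; first by case.
apply: ltn_pow2S_ind => B ltB.
  by rewrite !takS_lo ?slopeS_lo ?(ltnW ltB)//; have := IH _ ltB; lia.
by rewrite -addnS !takS_hi slopeS_hi; have := IH _ ltB; lia.
Qed.

Lemma tak_sym n B : B <= 2 ^ n -> tak n (2 ^ n - B) = tak n B.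
Proof.
elim: n B => [|n IH] B; first by case: B => [|[]].
rewrite expnS => leB; case: (leqP B (2 ^ n)) => leBn.
  rewrite (takS_lo leBn); have -> : 2 * 2 ^ n - B = 2 ^ n + (2 ^ n - B) by lia.
  by rewrite takS_hi IH//; lia.
have -> : B = 2 ^ n + (B - 2 ^ n) by lia.
rewrite takS_hi takS_lo; last by lia.
have -> : 2 * 2 ^ n - (2 ^ n + (B - 2 ^ n)) = 2 ^ n - (B - 2 ^ n) by lia.
by rewrite IH//; lia.
Qed.

Lemma slope_compl n B : B < 2 ^ n -> slope n (2 ^ n - B.+1) = (- slope n B)%R.
Proof.
elim: n B => [|n IH]; first by case.
apply: ltn_pow2S_ind => B ltB; rewrite expnS.
  have -> : 2 * 2 ^ n - B.+1 = 2 ^ n + (2 ^ n - B.+1) by lia.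
  by rewrite slopeS_hi slopeS_lo// IH//; lia.
have -> : 2 * 2 ^ n - (2 ^ n + B).+1 = 2 ^ n - B.+1 by lia.
by rewrite slopeS_hi slopeS_lo ?IH//; lia.
Qed.

Lemma slope_zero n : slope n 0 = n%:Z%R.
Proof. by elim: n => [//|n IH]; rewrite slopeS_lo ?expn_gt0// IH; lia. Qed.

Lemma slope_parity n B : exists k, (slope n B = n%:Z - 2 * k)%R.
Proof.
elim: n B => [|n IH] B; first by exists 0%R.
rewrite /=; case: ifP => _.
  by have [k ->] := IH B; exists k; lia.
by have [k ->] := IH (B - 2 ^ n); exists (k + 1)%R; lia.
Qed.

(** Integer form of the bound 2/3. Two leading digits are peeled at once: together they add at most
    [2 * 2 ^ n.*2] (exactly that for 01 and 10), which the bound absorbs, whereas one tent alone is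
    too high. The slack 2 later serves the geometric tail. *)
Lemma tak_le n B : B < 2 ^ n.*2 -> 3 * tak n.*2 B + 2 <= 2 * 2 ^ n.*2.
Proof.
elim: n B => [|n IH]; first by case.
rewrite doubleS; apply: ltn_pow2S_ind; apply: ltn_pow2S_ind => B ltB;
  have := IH _ ltB.
- rewrite takS_lo ?expnS; last by lia.
  by rewrite takS_lo; lia.
- rewrite takS_lo ?expnS; last by lia.
  by rewrite takS_hi; lia.
- rewrite takS_hi ?expnS takS_lo; lia.
- rewrite takS_hi ?expnS takS_hi; lia.
Qed.

Lemma slope_cat n p B C : B < 2 ^ n -> C < 2 ^ p ->
  slope (n + p) (B * 2 ^ p + C) = (slope n B + slope p C)%R.
Proof.
move=> + ltC; elim: n B => [|n IH].
  by case=> // _; rewrite mul0n !add0n add0r.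
have catlt B : B < 2 ^ n -> B * 2 ^ p + C < 2 ^ (n + p).
  by move=> ltB; rewrite expnD; nia.
apply: ltn_pow2S_ind => B ltB; rewrite addSn.
  by rewrite !slopeS_lo// ?IH ?catlt//; lia.
rewrite mulnDl -expnD -addnA !slopeS_hi IH//; lia.
Qed.

Lemma tak_cat n p B C : B < 2 ^ n -> C < 2 ^ p ->
  ((tak (n + p) (B * 2 ^ p + C))%:Z
   = (2 ^ p)%N%:Z * (tak n B)%:Z + (tak p C)%:Z + slope n B * C%:Z)%R.
Proof.
move=> + ltC; elim: n B => [|n IH].
  by case=> // _; rewrite mul0n !add0n /= mul0r addr0 mulr0 add0r.
have catlt B : B < 2 ^ n -> B * 2 ^ p + C < 2 ^ (n + p).
  by move=> ltB; rewrite expnD; nia.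
apply: ltn_pow2S_ind => B ltB; rewrite addSn.
  rewrite !takS_lo ?(ltnW (catlt _ _)) ?(ltnW ltB)// slopeS_lo//.
  rewrite PoszD IH// PoszD PoszM; ring.
rewrite mulnDl -expnD -addnA !takS_hi slopeS_hi PoszD IH//.
have -> : ((2 ^ (n + p) - (B * 2 ^ p + C))%N%:Z
  = (2 ^ p)%N%:Z * (2 ^ n - B)%N%:Z - C%:Z)%R.
  by have := catlt _ ltB; rewrite expnD; nia.
rewrite PoszD; ring.
Qed.

(** * Moments of the slopes and counting of balanced words *)

Lemma sum_slope_even n :
  (\sum_(0 <= B < 2 ^ n) slope n B ^+ 2 = (2 ^ n)%N%:Z * n%:Z /\
   \sum_(0 <= B < 2 ^ n) slope n B ^+ 4 <= (2 ^ n)%N%:Z * (3 * n%:Z ^+ 2))%R.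
Proof.
(* A new leading digit moves every slope by +1 or -1, as in a fair random walk. The fourth moment
   recursion involves the second, so both are carried in one induction. *)
have split_sum (F : int -> int) m : (\sum_(0 <= B < 2 ^ m.+1) F (slope m.+1 B) =
    \sum_(0 <= B < 2 ^ m) (F (slope m B + 1) + F (slope m B - 1)))%R.
  rewrite expnS mul2n -addnn (big_cat_nat (n := 2 ^ m)) ?leq_addr//=.
  rewrite big_split; congr (_ + _)%R.
    by apply: eq_big_nat => B /andP[_ ltB]; rewrite ltB.
  rewrite -{1}[2 ^ m]add0n big_addn addnK.
  by apply: eq_big_nat => B /andP[_ ltB]; rewrite ltnNge leq_addl/= addnK.
elim: n => [|n [IH2 IH4]].
  by rewrite expn0 !big_nat1.
split.
  rewrite (split_sum (fun x => x ^+ 2)%R).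
  have E2 (x : int) : ((x + 1) ^+ 2 + (x - 1) ^+ 2 = 2 * x ^+ 2 + 2)%R by ring.
  under eq_bigr do rewrite E2.
  rewrite big_split/= -big_distrr/= IH2 sumr_const_nat subn0 expnS; lia.
rewrite (split_sum (fun x => x ^+ 4)%R).
have E4 (x : int) :
    ((x + 1) ^+ 4 + (x - 1) ^+ 4 = 2 * x ^+ 4 + 12 * x ^+ 2 + 2)%R by ring.
under eq_bigr do rewrite E4.
rewrite !big_split/= -!big_distrr/= IH2 sumr_const_nat subn0 expnS.
move: IH4; set S4 := (\sum_(0 <= B < _) _)%R; set p := 2 ^ n => IH4.
rewrite !natz PoszM -(addn1 n) PoszD.
set q := Posz p in IH4 *; set m := Posz n in IH4 *.
have q0 : (0 <= q)%R by [].
have -> : (2%Z * q * (3 * (m + 1) ^+ 2)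
         = 2 * (q * (3 * m ^+ 2)) + 12 * (q * m) + 6 * q)%R.
  by ring.
by lra.
Qed.

(** The walk starts at 0 and stands at [2 ^ n] at the midpoint [B = 2 ^ n]; the step into its first
    point above [v] is the crossing. *)
Lemma tak_crossing n v : v < 2 ^ n ->
  exists2 B, B < 2 ^ n.+1 & tak n.+1 B <= v < tak n.+1 B.+1.
Proof.
move=> ltv.
have ex : exists B, v < tak n.+1 B.
  by exists (2 ^ n); rewrite takS_lo// tak_pow2.
have [[|B] vB minB] := ex_minnP ex; first by rewrite tak0 in vB.
exists B.
  have /minB : v < tak n.+1 (2 ^ n) by rewrite takS_lo// tak_pow2.
  by rewrite expnS; lia.
by rewrite vB andbT leqNgt; apply/negP => /minB; rewrite ltnn.
Qed.

Definition slope_values n d :=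
  undup [seq tak n B | B <- iota 0 (2 ^ n) & slope n B == Posz d].

Lemma sum_in_interval_le m u d : \sum_(0 <= v < m) (u <= v < u + d) <= d.
Proof.
have [um|um] := leqP u m; last first.
  rewrite big_nat big1// => v /andP[_ vm]; lia.
rewrite (big_cat_nat (n := u))//= big_nat big1 ?add0n; last by lia.
apply: (@leq_trans (\sum_(u <= v < maxn m (u + d)) (v < u + d))).
  have mm : m <= maxn m (u + d) by lia.
  rewrite [leqRHS](big_cat_nat um mm)/=.
  apply: leq_trans (leq_addr _ _).
  by rewrite !big_nat leq_sum// => v /andP[->].
have ud : u + d <= maxn m (u + d) by lia.
rewrite (big_cat_nat (leq_addr d u) ud)/=.
rewrite [X in _ + X]big_nat [X in _ + X]big1; last by lia.
rewrite addn0 (leq_trans (n := \sum_(u <= v < u + d) 1))//; last first.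
  by rewrite sum_nat_const_nat; lia.
by apply: leq_sum => v _; case: (_ < _).
Qed.

(* Each level [v < 2 ^ n.-1] is crossed upwards by some step of the walk [tak n].
   The steps above [K] are too rare to account for more than half of the levels,
   and a value reached with slope [d <= K] accounts for at most [K] of them. *)
Lemma many_slope_values n K : 0 < n -> 0 < K -> 12 * n ^ 2 <= K ^ 3 ->
  exists2 d, 0 < d <= K & 2 ^ n <= 4 * K ^ 2 * size (slope_values n d).
Proof.
move=> n0 K0 Kn.
have [/hasP[d]|/hasPn few] := boolP (has (fun d =>
    2 ^ n <= 4 * K ^ 2 * size (slope_values n d)) (index_iota 1 K.+1)).
  by rewrite mem_index_iota; exists d.
exfalso.
(* [big] bounds the levels crossed by steps of slope above [K]; [small] charges [K] levels to each
   distinct value left with slope [1 <= d <= K]. *)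
pose big := \sum_(0 <= B < 2 ^ n) (K%:Z < slope n B)%R * `|slope n B|.
pose small := \sum_(1 <= d < K.+1) K * size (slope_values n d).
have cover : 2 ^ n.-1 <= big + small.
  have -> : 2 ^ n.-1 = \sum_(0 <= v < 2 ^ n.-1) 1 by rewrite sum_nat_const_nat; lia.
  apply: (@leq_trans (\sum_(0 <= v < 2 ^ n.-1)
    (\sum_(0 <= B < 2 ^ n)
        (K%:Z < slope n B)%R * (tak n B <= v < tak n B + `|slope n B|) +
     \sum_(1 <= d < K.+1) \sum_(u <- slope_values n d) (u <= v < u + d)))).
    rewrite !big_nat; apply: leq_sum => v /andP[_ ltv].
    have [B ltB vB] := tak_crossing ltv; rewrite prednK// in ltB vB.
    have succB := tak_succ ltB.
    have vB' : tak n B <= v < tak n B + `|slope n B| by lia.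
    have [KB|KB] := ltP K%:Z%R (slope n B).
      rewrite (bigD1_seq B) ?iota_uniq ?mem_index_iota//= KB vB'; lia.
    rewrite addnC (bigD1_seq `|slope n B|%N) ?iota_uniq ?mem_index_iota//=; last by lia.
    rewrite (bigD1_seq (tak n B)) ?undup_uniq ?vB'//= /slope_values mem_undup.
    apply: map_f; rewrite mem_filter mem_iota ltB andbT; lia.
  rewrite big_split/= leq_add//.
    rewrite exchange_big/= /big; apply: leq_sum => B _.
    by rewrite -big_distrr/= leq_mul2l sum_in_interval_le orbT.
  rewrite exchange_big/= /small !big_nat; apply: leq_sum => d /andP[_ ltd].
  rewrite exchange_big/=.
  apply: (@leq_trans (\sum_(u <- slope_values n d) d)).
    by apply: leq_sum => u _; apply: sum_in_interval_le.
  by rewrite big_const_seq count_predT iter_addn_0 leq_mul2r -ltnS ltd orbT.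
have big_le : 4 * big <= 2 ^ n.
  (* Markov's inequality on the fourth moment: a slope [D > K] satisfies [D * K ^ 3 <= D ^ 4]. *)
  have KB : big * K ^ 3 <= 2 ^ n * (3 * n ^ 2).
    rewrite -lez_nat; have [_] := sum_slope_even n.
    have -> : Posz (2 ^ n * (3 * n ^ 2)) = ((2 ^ n)%N%:Z * (3 * n%:Z ^+ 2))%R by lia.
    apply: le_trans; rewrite big_distrl/= (big_morph Posz PoszD erefl).
    apply: ler_sum => B _; case: ltP => KB; last by rewrite !mul0n; nia.
    rewrite mul1n; move: (slope n B) KB => D KB.
    have -> : D = Posz `|D| by lia.
    rewrite absz_nat.
    rewrite -[(Posz `|D| ^+ 4)%R]/(Posz `|D| * (Posz `|D| * (Posz `|D| * Posz `|D|)))%R.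
    rewrite -!PoszM lez_nat leq_mul2l; apply/orP; right.
    have : K <= `|D| by lia.
    by move=> KD; rewrite !expnS expn0 muln1 !leq_mul.
  have : 4 * big * (12 * n ^ 2) <= 2 ^ n * (12 * n ^ 2) by nia.
  by rewrite leq_pmul2r//; nia.
(* Each strict bound in [few] saves at least 1; the saved [K * K] keeps the summed inequality
   strict. *)
have small_lt : 4 * small < 2 ^ n.
  have : 4 * K ^ 2 * small + K * K <= K * K * 2 ^ n.
    rewrite big_distrr/=.
    have -> : K * K = \sum_(1 <= d < K.+1) K by rewrite sum_nat_const_nat; lia.
    rewrite -big_split big_distrl/= !big_nat; apply: leq_sum => d dK.
    have := few d; rewrite mem_index_iota => /(_ dK); rewrite -ltnNge => lt2n.
    rewrite -[X in _ + X]muln1 mulnCA -mulnDr leq_mul2l; apply/orP; right.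
    by rewrite addn1.
  nia.
(* Contradiction: [4 * (big + small)] is below [2 * 2 ^ n], which is [4 * 2 ^ n.-1]. *)
have := expnS 2 n.-1; rewrite prednK// => e2n.
by move: big_le small_lt cover; rewrite e2n; lia.
Qed.

Lemma slope_ones p : slope p (2 ^ p - 1) = (- p%:Z)%R.
Proof. by rewrite slope_compl ?expn_gt0// slope_zero. Qed.

Lemma choose_preimages (T1 T2 : eqType) (f : T1 -> T2) (s : seq T1) :
  exists2 t, {subset t <= s} & map f t = undup (map f s).
Proof.
elim: s => [|x s [t ts tE]]; first by exists [::].
rewrite /=; case: ifP => _.
  by exists t => // y /ts ys; rewrite inE ys orbT.
exists (x :: t); last by rewrite /= tE.
by move=> y; rewrite !inE => /predU1P[->|/ts->]; rewrite ?eqxx ?orbT.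
Qed.

Lemma many_balanced k : 0 < k -> exists m (s : seq nat),
  [/\ 0 < m, m.*2 <= 12 * k ^ 3 + 12 * k ^ 2,
      forall B, B \in s -> B < 2 ^ m.*2 /\ slope m.*2 B = 0%R,
      uniq (map (tak m.*2) s) & 2 ^ (12 * k ^ 3) <= 576 * k ^ 4 * size s].
Proof.
(* Chosen so that [12 * n ^ 2 = K ^ 3] and [4 * K ^ 2 = 576 * k ^ 4]. *)
move=> k0; set n := 12 * k ^ 3; set K := 12 * k ^ 2.
have k20 : 0 < k ^ 2 by rewrite expn_gt0 k0.
have k30 : 0 < k ^ 3 by rewrite expn_gt0 k0.
have n0 : 0 < n by lia.
have K0 : 0 < K by lia.
have Kn : 12 * n ^ 2 <= K ^ 3.
  by rewrite /n /K; nia.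
have [d /andP[d0 dK]] := many_slope_values n0 K0 Kn.
rewrite /slope_values.
have [t ts tE] := choose_preimages (tak n)
  [seq B <- iota 0 (2 ^ n) | slope n B == d%:Z%R].
have ut : uniq (map (tak n) t) by rewrite tE undup_uniq.
rewrite -tE size_map => nt.
have tP B : B \in t -> B < 2 ^ n /\ slope n B = d.
  by move=> /ts; rewrite mem_filter mem_iota add0n => /andP[/eqP].

have lt1 : 2 ^ d - 1 < 2 ^ d by rewrite subn1 prednK ?expn_gt0.
(* Slopes have the parity of [n], and [t] is nonempty because [2 ^ n] is positive. *)
have [m nd] : exists m, n + d = m.*2.
  case: t nt tP {ts tE ut} => [|B t _ /(_ B (mem_head B t))[_ sB]].
    by rewrite /= muln0 leqNgt expn_gt0.
  by have [j] := slope_parity n B; rewrite sB => nd; exists ((n + d)./2); lia.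
exists m, [seq B * 2 ^ d + (2 ^ d - 1) | B <- t]; rewrite -nd; split.
- lia.
- lia.
- move=> _ /mapP[B /tP[ltB sB] ->]; split; first by rewrite expnD; nia.
  by rewrite slope_cat// slope_ones sB addrN.
(* All words share the slope [d] and the appended block, so by [tak_cat] their values undergo one
   injective affine map. *)
- pose c := tak d (2 ^ d - 1) + d * (2 ^ d - 1).
  have -> : map (tak (n + d)) [seq B * 2 ^ d + (2 ^ d - 1) | B <- t] =
      map (fun v => 2 ^ d * v + c) (map (tak n) t).
    rewrite -!map_comp; apply/eq_in_map => B /tP[ltB sB] /=; apply/eqP.
    by rewrite -eqz_nat tak_cat// sB /c !PoszD !PoszM addrA.
  by rewrite map_inj_uniq// => u v /addIn/eqP; rewrite eqn_pmul2l ?expn_gt0// => /eqP.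
- rewrite size_map (leq_trans nt)// leq_mul2r; apply/orP; right.
  by rewrite /K; nia.
Qed.

Local Open Scope classical_set_scope.
Local Open Scope ring_scope.

(** Absorbs the polynomial factor by [576 <= 2 ^ 10] and [k ^ 4 <= 2 ^ (4 * k)], so that the count
    can be compared with the base through exponents alone. *)
Lemma many_balanced_pow2 k : (2 < k)%N -> exists m (s : seq nat),
  [/\ (0 < m)%N, (m.*2 <= 12 * k ^ 3 + 12 * k ^ 2)%N,
      forall B, B \in s -> (B < 2 ^ m.*2)%N /\ slope m.*2 B = 0,
      uniq (map (tak m.*2) s) &
      (2 ^ (12 * k ^ 3 - (12 * k ^ 2 + 24 * k)) <= size s)%N].
Proof.
move=> k2; have [|m [s [m0 mk sB us ms]]] := @many_balanced k; first by lia.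
exists m, s; split => //.
have k4 : (0 < 576 * k ^ 4)%N by rewrite muln_gt0 expn_gt0; lia.
rewrite -(leq_pmul2l k4) (leq_trans _ ms)//.
have {2}-> : (12 * k ^ 3 = 12 * k ^ 2 + 24 * k + (12 * k ^ 3 - (12 * k ^ 2 + 24 * k)))%N.
  by rewrite subnKC// !expnS expn0; nia.
rewrite [leqRHS]expnD leq_mul2r; apply/orP; right.
have kpow : (k ^ 4 <= 2 ^ (4 * k))%N.
  by rewrite mulnC expnM leq_exp2r// ltnW// ltn_expl.
apply: (@leq_trans (2 ^ 10 * 2 ^ (4 * k))); first exact: leq_mul.
by rewrite -expnD leq_exp2l//; lia.
Qed.

(** * Expansions in base b *)

Section Expansion.
Variables (R : realType) (b : nat).
Hypothesis b1 : (1 < b)%N.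
Implicit Types u v : nat -> nat.

Definition digit_series u : R^nat := series (fun k => (u k)%:R / b%:R ^+ k.+1).
Definition expansion u : R := limn (digit_series u).

Let b0 : 0 < b%:R :> R. Proof. by rewrite ltr0n ltnW. Qed.
Let b1R : 1 < b%:R :> R. Proof. by rewrite ltr1n. Qed.
Let predbE : b.-1%:R / (b%:R - 1) = 1 :> R.
Proof.
by rewrite -subn1 natrB; [rewrite divff// subr_eq0 gt_eqF|exact: ltnW].
Qed.
Let digit_series0 u : digit_series u 0 = 0.
Proof. by rewrite /digit_series seriesEnat /= big_nil. Qed.

Lemma digit_seriesS u n :
  digit_series u n.+1 = digit_series u n + (u n)%:R / b%:R ^+ n.+1.
Proof. by rewrite /digit_series seriesEnat /= big_nat_recr. Qed.

Lemma eq_digit_series u v n : (forall k, (k < n)%N -> u k = v k) ->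
  digit_series u n = digit_series v n.
Proof.
move=> uv; rewrite /digit_series !seriesEnat /=.
by apply: eq_big_nat => k /andP[_ /uv ->].
Qed.

Lemma digit_series_nd u m n : (m <= n)%N -> digit_series u m <= digit_series u n.
Proof.
move=> /subnKC <-; elim: (n - m)%N => [|k IH]; first by rewrite addn0.
by rewrite addnS digit_seriesS (le_trans IH)// lerDl divr_ge0// exprn_ge0// ltW.
Qed.

(** The correction term is the value of all remaining places filled with [q]; replacing one such [q]
    by an actual digit can only lower the total. *)
Lemma digit_series_tail u q m n : (forall k, (u k <= q)%N) -> (m <= n)%N ->
  digit_series u n + q%:R / (b%:R - 1) / b%:R ^+ n <=
  digit_series u m + q%:R / (b%:R - 1) / b%:R ^+ m.
Proof.
move=> uq /subnKC <-; elim: (n - m)%N => [|k IH]; first by rewrite addn0.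
rewrite addnS (le_trans _ IH)// digit_seriesS -addrA lerD2l.
have bm : 0 < b%:R ^+ (m + k) :> R by rewrite exprn_gt0.
have -> : q%:R / (b%:R - 1) / b%:R ^+ (m + k) =
    q%:R / b%:R ^+ (m + k).+1 + q%:R / (b%:R - 1) / b%:R ^+ (m + k).+1 :> R.
  by rewrite exprS; field; rewrite !gt_eqF// subr_gt0.
by rewrite lerD2r ler_pM2r ?ler_nat// invr_gt0 exprn_gt0.
Qed.

Lemma digit_series_le u q n m : (forall k, (u k <= q)%N) ->
  digit_series u m <= digit_series u n + q%:R / (b%:R - 1) / b%:R ^+ n.
Proof.
move=> uq.
have tail k : 0 <= q%:R / (b%:R - 1) / b%:R ^+ k :> R.
  by rewrite !divr_ge0// ?exprn_ge0 ?subr_ge0 ltW.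
have [mn|nm] := leqP m n.
  by rewrite (le_trans (digit_series_nd u mn))// lerDl.
by rewrite (le_trans _ (digit_series_tail uq (ltnW nm)))// lerDl.
Qed.

Lemma digit_series_cvg u q : (forall k, (u k <= q)%N) ->
  digit_series u @ \oo --> expansion u.
Proof.
move=> uq; apply: nondecreasing_is_cvgn; first by move=> m n; apply: digit_series_nd.
exists (digit_series u 0 + q%:R / (b%:R - 1) / b%:R ^+ 0) => _ [m _ <-].
exact: digit_series_le.
Qed.

Lemma expansion_ge u q n : (forall k, (u k <= q)%N) -> digit_series u n <= expansion u.
Proof.
move=> uq; apply: limr_ge; first exact: digit_series_cvg uq.
by near=> m; apply: digit_series_nd; near: m; exact: nbhs_infty_ge.
Unshelve. all: by end_near. Qed.

Lemma expansion_le u q n : (forall k, (u k <= q)%N) ->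
  expansion u <= digit_series u n + q%:R / (b%:R - 1) / b%:R ^+ n.
Proof.
move=> uq; apply: limr_le; first exact: digit_series_cvg uq.
by near=> m; apply: digit_series_le.
Unshelve. all: by end_near. Qed.

Lemma cvg_div_base C : (C / b%:R ^+ n) @[n --> \oo] --> (0 : R).
Proof.
rewrite -(mulr0 C); under eq_fun do rewrite -exprVn.
apply: cvgMr; apply: cvg_expr; rewrite ger0_norm ?invr_ge0 ?(ltW b0)//.
by rewrite invf_lt1.
Qed.

Lemma expansion_unique u x C :
  (forall n, digit_series u n <= x <= digit_series u n + C / b%:R ^+ n) ->
  expansion u = x.
Proof.
move=> ux; apply/cvg_lim => //.
apply: (@squeeze_cvgr _ _ _ _ (fun n => x - C / b%:R ^+ n) (fun=> x)).
- by near=> n; have := ux n; lra.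
- by rewrite -[X in _ --> X]subr0; apply: cvgB; [exact: cvg_cst|exact: cvg_div_base].
- exact: cvg_cst.
Unshelve. all: by end_near. Qed.

Lemma digit_series_recl u n :
  digit_series u n.+1 = ((u 0%N)%:R + digit_series (fun k => u k.+1) n) / b%:R.
Proof.
elim: n => [|n IH].
  rewrite digit_seriesS /digit_series !seriesEnat /= !big_nil; field.
  by rewrite gt_eqF.
rewrite digit_seriesS IH digit_seriesS !exprS; field.
by rewrite !gt_eqF// exprn_gt0.
Qed.

Lemma expansion_recl u q : (forall k, (u k <= q)%N) ->
  expansion u = ((u 0%N)%:R + expansion (fun k => u k.+1)) / b%:R.
Proof.
move=> uq; have uq' k : (u k.+1 <= q)%N by [].
apply/cvg_lim => //; rewrite -cvg_shiftS; under eq_fun do rewrite digit_series_recl.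
by apply: cvgMl; apply: cvgD; [exact: cvg_cst|exact: digit_series_cvg uq'].
Qed.

Lemma expansion_itv u : (forall k, (u k < b)%N) -> 0 <= expansion u <= 1.
Proof.
move=> ub; have uq k : (u k <= b.-1)%N by rewrite -ltnS prednK// ltnW.
have := expansion_ge 0 uq; have := expansion_le 0 uq.
by rewrite predbE digit_series0 add0r expr0 divr1 => -> ->.
Qed.

Lemma expansion_dist u v n : (forall k, (u k < b)%N) -> (forall k, (v k < b)%N) ->
  (forall k, (k < n)%N -> u k = v k) ->
  `|expansion u - expansion v| <= (b%:R ^+ n)^-1.
Proof.
move=> ub vb uv.
have uq k : (u k <= b.-1)%N by rewrite -ltnS prednK// ltnW.
have vq k : (v k <= b.-1)%N by rewrite -ltnS prednK// ltnW.
have := expansion_ge n uq; have := expansion_le n uq.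
have := expansion_ge n vq; have := expansion_le n vq.
rewrite (eq_digit_series uv) predbE div1r.
by rewrite ler_distlC; lra.
Qed.

(* Leaving out the largest digit leaves room between neighbouring cylinders. *)
Lemma expansion_gap u v n : (forall k, ((u k).+2 <= b)%N) ->
  (forall k, ((v k).+2 <= b)%N) -> (forall k, (k < n)%N -> u k = v k) ->
  u n != v n -> (b%:R ^+ n.+2)^-1 <= `|expansion u - expansion v|.
Proof.
wlog: u v / (u n < v n)%N => [wl ub vb uv neq|ltuv ub vb uv _].
  have [lt|gt|eq] := ltngtP (u n) (v n); last by rewrite eq eqxx in neq.
    exact: wl.
  rewrite distrC; apply: wl => //; last by rewrite eq_sym.
  by move=> k /uv.
have uq k : (u k <= b - 2)%N by have := ub k; lia.
have vq k : (v k <= b - 2)%N by have := vb k; lia.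
have := expansion_le n.+1 uq; have := expansion_ge n.+1 vq.
rewrite !digit_seriesS (eq_digit_series uv).
set S := digit_series v n; set x := expansion u; set y := expansion v.
set p : R := b%:R ^+ n.+1; have p0 : 0 < p by rewrite exprn_gt0.
have : (u n)%:R / p + 1 / p <= (v n)%:R / p.
  by rewrite -mulrDl ler_pM2r ?invr_gt0// natr1 ler_nat.
rewrite natrB; last by lia.
(* The digits of [u] after place [n] fill at most (b-2)/(b-1) of the unit [1 / p]; the share 1/(b-1)
   left over exceeds 1/b. *)
have -> : (b%:R - 2) / (b%:R - 1) / p = 1 / p - (b%:R - 1)^-1 / p.
  by field; rewrite !gt_eqF ?subr_gt0.
have : (b%:R ^+ n.+2)^-1 <= (b%:R - 1)^-1 / p.
  rewrite exprSr -/p invfM mulrC ler_pM2r ?invr_gt0// lef_pV2 ?posrE ?subr_gt0//.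
  by lra.
rewrite distrC => h1 h2 h3 h4; rewrite (le_trans _ (ler_norm _))//; lra.
Qed.

Lemma expansion_surj x : 0 <= x < 1 ->
  exists2 u, (forall k, (u k < b)%N) & expansion u = x.
Proof.
move=> /andP[x0 x1].
(* The usual digits, floor(b^(k+1) x) mod b; the partial sums are then floor(b^n x) / b^n. *)
exists (fun k => Num.truncn (b%:R ^+ k.+1 * x) %% b)%N.
  by move=> k; rewrite ltn_mod ltnW.
apply: (@expansion_unique _ _ 1) => n.
have p0 k : 0 < b%:R ^+ k :> R by rewrite exprn_gt0.
suff -> : digit_series (fun k => Num.truncn (b%:R ^+ k.+1 * x) %% b)%N n =
    (Num.truncn (b%:R ^+ n * x))%:R / b%:R ^+ n.
  have /andP[] := truncn_itv (mulr_ge0 (ltW (p0 n)) x0).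
  rewrite ler_pdivrMr// -mulrDl ler_pdivlMr// mulrC => -> /ltW.
  by rewrite -natr1.
elim: n => [|n IH].
  rewrite /digit_series seriesEnat /= big_nil expr0 mul1r divr1.
  suff -> : Num.truncn x = 0%N by [].
  by apply: truncn_def; rewrite x0 x1.
rewrite digit_seriesS IH.
set m := Num.truncn (b%:R ^+ n.+1 * x).
have -> : Num.truncn (b%:R ^+ n * x) = (m %/ b)%N.
  have /andP[] := truncn_itv (mulr_ge0 (ltW (p0 n.+1)) x0).
  rewrite -/m exprSr -mulrA mulrCA => mle mlt.
  apply/truncn_def/andP; split.
    rewrite -(ler_pM2l b0) -natrM (le_trans _ mle)// ler_nat mulnC.
    exact: leq_divM.
  rewrite -(ltr_pM2l b0) -natrM (lt_le_trans mlt)// ler_nat mulnC.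
  by rewrite ltn_ceil// ltnW.
rewrite [in RHS](divn_eq m b) natrD natrM exprSr; field.
by rewrite !gt_eqF.
Qed.

End Expansion.

(** * Self-affinity of the Takagi function *)

Section Takagi.
Variable R : realType.
Implicit Types x t : R.

Lemma dist_nearest_intE t (m : int) : `|t - m%:~R| <= 2^-1 ->
  dist_nearest_int t = `|t - m%:~R|.
Proof.
move=> tm; apply/eqP; rewrite eq_le; apply/andP; split.
  apply: ge_inf; last by exists m.
  by exists 0 => _ [k _ <-].
apply: lb_le_inf; first by exists `|t - m%:~R|, m.
move=> _ [k _ <-]; have [->//|km] := eqVneq k m.
have : 1 <= `|k%:~R - m%:~R| :> R.
  by rewrite -intrB -intr_norm ler1z -gtz0_ge1 normr_gt0 subr_eq0.
have := ler_distD t (k%:~R : R) m%:~R; rewrite (distrC _ t); lra.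
Qed.

Lemma dist_nearest_int_id t : 0 <= t <= 2^-1 -> dist_nearest_int t = t.
Proof.
move=> /andP[t0 t1].
by rewrite (@dist_nearest_intE _ 0) subr0 ger0_norm.
Qed.

Lemma dist_nearest_int_subr t : 2^-1 <= t <= 1 -> dist_nearest_int t = 1 - t.
Proof.
move=> /andP[t0 t1].
by rewrite (@dist_nearest_intE _ 1) distrC ger0_norm; lra.
Qed.

Lemma dist_nearest_intD1 t : dist_nearest_int (t + 1) = dist_nearest_int t.
Proof.
congr inf; apply/seteqP; split => _ [m _ <-].
  by exists (m - 1) => //; rewrite intrB; congr `|_|; ring.
by exists (m + 1) => //; rewrite intrD; congr `|_|; ring.
Qed.

Lemma dist_nearest_intDn t n : dist_nearest_int (t + n%:R) = dist_nearest_int t.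
Proof.
by elim: n => [|n IH]; rewrite ?addr0// -natr1 addrA dist_nearest_intD1.
Qed.

Lemma dist_nearest_int_itv t : 0 <= dist_nearest_int t <= 1.
Proof.
have := floor_itv t => /andP[ft tf].
have lb0 : 0 <= dist_nearest_int t.
  by apply: lb_le_inf; [exists `|t - 0%:~R|, 0|move=> _ [k _ <-]].
rewrite lb0; apply: (@le_trans _ _ `|t - (Num.floor t)%:~R|).
  apply: ge_inf; last by exists (Num.floor t).
  by exists 0 => _ [k _ <-].
rewrite ger0_norm ?subr_ge0//; move: tf; rewrite intrD; lra.
Qed.

Definition takagi_series x : R^nat :=
  series (fun n => dist_nearest_int (2 ^+ n * x) / 2 ^+ n).

Lemma takagi_seriesS x n : takagi_series x n.+1 =
  takagi_series x n + dist_nearest_int (2 ^+ n * x) / 2 ^+ n.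
Proof. by rewrite /takagi_series seriesEnat /= big_nat_recr. Qed.

Lemma takagi_series_recl x n :
  takagi_series x n.+1 = dist_nearest_int x + takagi_series (2 * x) n / 2.
Proof.
elim: n => [|n IH].
  by rewrite /takagi_series !seriesEnat /= big_nat1 big_nil expr0 mul1r; lra.
rewrite takagi_seriesS IH takagi_seriesS (mulrA (2 ^+ n)) -exprSr exprSr; field.
by rewrite expf_neq0.
Qed.

Lemma takagi_series_ge0 x n : 0 <= takagi_series x n.
Proof.
rewrite /takagi_series seriesEnat /= sumr_ge0// => k _.
by have /andP[d0 _] := dist_nearest_int_itv (2 ^+ k * x); rewrite divr_ge0.
Qed.

Lemma takagi_series_nd x : nondecreasing_seq (takagi_series x).
Proof.
apply/nondecreasing_seqP => n; rewrite takagi_seriesS lerDl.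
by have /andP[d0 _] := dist_nearest_int_itv (2 ^+ n * x); rewrite divr_ge0.
Qed.

Lemma takagi_series_le2 x n : takagi_series x n <= 2.
Proof.
suff : takagi_series x n <= 2 - 2 / 2 ^+ n.
  by move/le_trans; apply; rewrite gerBl divr_ge0.
elim: n => [|n IH].
  by rewrite /takagi_series seriesEnat /= big_nil; lra.
rewrite takagi_seriesS.
have /andP[_ d1] := dist_nearest_int_itv (2 ^+ n * x).
have p0 : 0 < (2 ^+ n)^-1 :> R by rewrite invr_gt0 exprn_gt0.
have : dist_nearest_int (2 ^+ n * x) / 2 ^+ n <= 1 / 2 ^+ n by rewrite ler_pM2r.
rewrite exprS invfM; lra.
Qed.

Lemma takagi_series_cvg x : takagi_series x @ \oo --> takagi x.
Proof.
apply: nondecreasing_is_cvgn; first exact: takagi_series_nd.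
by exists 2 => _ [n _ <-]; exact: takagi_series_le2.
Qed.

Lemma takagi_itv x : 0 <= takagi x <= 2.
Proof.
apply/andP; split.
  apply: limr_ge; first exact: takagi_series_cvg.
  by apply: nearW => n; exact: takagi_series_ge0.
apply: limr_le; first exact: takagi_series_cvg.
by apply: nearW => n; exact: takagi_series_le2.
Qed.

Lemma takagi_recl x : takagi x = dist_nearest_int x + takagi (2 * x) / 2.
Proof.
apply/cvg_lim => //; rewrite -/(takagi_series x) -cvg_shiftS.
under eq_fun do rewrite takagi_series_recl.
by apply: cvgD; [exact: cvg_cst|apply: cvgMl; exact: takagi_series_cvg].
Qed.

Lemma takagi_half x : 0 <= x <= 1 -> takagi (x / 2) = x / 2 + takagi x / 2.
Proof.
move=> /andP[x0 x1]; rewrite takagi_recl (mulrC 2) divfK// dist_nearest_int_id//.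
lra.
Qed.

Lemma takagiD1 x : takagi (1 + x) = takagi x.
Proof.
congr (limn _); congr series; apply/funext => n /=.
by rewrite mulrDr mulr1 addrC -natrX dist_nearest_intDn.
Qed.

Lemma takagi_halfD1 x : 0 <= x <= 1 ->
  takagi ((1 + x) / 2) = (1 - x) / 2 + takagi x / 2.
Proof.
move=> /andP[x0 x1]; rewrite takagi_recl (mulrC 2) divfK// takagiD1.
by rewrite dist_nearest_int_subr; lra.
Qed.

(** Exact self-affinity, by induction on the leading digit: a leading 0 adds the rising half of the
    tent and a leading 1 the falling half, which changes the shear by +1 or -1. *)
Lemma takagi_cylinder n B x : (B < 2 ^ n)%N -> 0 <= x <= 1 ->
  takagi ((B%:R + x) / 2 ^+ n) =
  ((tak n B)%:R + (slope n B)%:~R * x + takagi x) / 2 ^+ n.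
Proof.
move=> + x01; elim: n B => [|n IH].
  by case=> // _; rewrite !expr0 !divr1 /= !add0r mul0r add0r.
have cyl01 B : (B < 2 ^ n)%N -> 0 <= (B%:R + x) / 2 ^+ n <= 1.
  move=> ltB; have /andP[x0 x1] := x01.
  rewrite divr_ge0 ?addr_ge0//= ler_pdivrMr ?exprn_gt0// mul1r -natrX.
  rewrite (le_trans (lerD (lexx _) x1))// natr1 ler_nat//.
have p0 : 2 ^+ n != 0 :> R by rewrite expf_neq0.
apply: ltn_pow2S_ind => B ltB.
  have -> : (B%:R + x) / 2 ^+ n.+1 = ((B%:R + x) / 2 ^+ n) / 2 by rewrite exprS; field.
  rewrite takagi_half ?cyl01// IH// takS_lo ?(ltnW ltB)// slopeS_lo//.
  by rewrite natrD intrD exprS; field.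
have -> : ((2 ^ n + B)%:R + x) / 2 ^+ n.+1 = (1 + (B%:R + x) / 2 ^+ n) / 2.
  by rewrite exprS natrD natrX; field.
rewrite takagi_halfD1 ?cyl01// IH// takS_hi slopeS_hi.
by rewrite natrD natrB ?(ltnW ltB)// natrX intrB exprS; field.
Qed.

Lemma takagi_expansion N (u : nat -> nat) : (0 < N)%N ->
  (forall k, (u k < 2 ^ N)%N) -> (forall k, slope N (u k) = 0) ->
  takagi (expansion R (2 ^ N) u) = expansion R (2 ^ N) (tak N \o u).
Proof.
move=> N0; have b1 : (1 < 2 ^ N)%N by rewrite -[1%N](expn0 2) ltn_exp2l.
move=> u0 s0.
(* With zero shear each block splits off as one digit. The remainder after [n] blocks lies between 0
   and [2 / b ^ n] for the base [b], whence the constant 2 in [expansion_unique]. *)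
suff tail n : takagi (expansion R (2 ^ N) u) =
    digit_series R (2 ^ N) (tak N \o u) n +
    takagi (expansion R (2 ^ N) (fun k => u (k + n)%N)) / (2 ^ N)%:R ^+ n.
  symmetry; apply: (@expansion_unique _ _ b1 _ _ 2) => n; rewrite (tail n).
  have /andP[t0 t2] := takagi_itv (expansion R (2 ^ N) (fun k => u (k + n)%N)).
  have p0 : 0 < (2 ^ N)%:R :> R by rewrite ltr0n expn_gt0.
  by rewrite lerDl lerD2l divr_ge0 ?exprn_ge0 ?(ltW p0)//= ler_pM2r ?invr_gt0 ?exprn_gt0.
elim: n => [|n IH].
  rewrite /digit_series seriesEnat /= big_nil add0r expr0 divr1.
  by congr takagi; congr expansion; apply/funext => k; rewrite addn0.
rewrite IH digit_seriesS -addrA; congr (_ + _).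
have ub k : (u (k + n)%N <= (2 ^ N).-1)%N by rewrite -ltnS prednK ?expn_gt0.
rewrite (expansion_recl R b1 ub) {1}natrX takagi_cylinder//; last first.
  exact: expansion_itv.
rewrite s0 mul0r addr0 -natrX add0n /=.
have p0 : (2 ^ N)%:R != 0 :> R by rewrite pnatr_eq0 -lt0n expn_gt0.
under eq_fun do rewrite addSnnS.
by rewrite exprS; field; rewrite p0 expf_neq0.
Qed.

End Takagi.

(** * Hausdorff dimension of Cantor sets *)

Section Hausdorff.
Variable R : realType.
Implicit Types (A : set R) (s x y : R).

Lemma diameter_ge A x y : A x -> A y -> (`|x - y|%:E <= diameter A)%E.
Proof. by move=> Ax Ay; apply: ereal_sup_ubound; exists x => //; exists y. Qed.

Lemma hausdorff_weight_ge0 s A : (0 <= hausdorff_weight s A)%E.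
Proof. by rewrite /hausdorff_weight; case: ifP => // _; exact: poweR_ge0. Qed.

Lemma hausdorff_weight_ge s A x y : 0 <= s -> A x -> A y ->
  ((`|x - y| `^ s)%:E <= hausdorff_weight s A)%E.
Proof.
move=> s0 Ax Ay; rewrite /hausdorff_weight ifF; last first.
  by apply/negbTE/set0P; exists x.
have xy := diameter_ge Ax Ay.
rewrite -poweR_EFin; apply: gt0_ler_poweR => //.
- by rewrite in_itv/= leey lee_fin normr_ge0.
- by rewrite in_itv/= leey andbT (le_trans _ xy)// lee_fin.
Qed.

Lemma hausdorff_weight_le s r A : 0 <= s -> 0 <= r -> (diameter A <= r%:E)%E ->
  (hausdorff_weight s A <= (r `^ s)%:E)%E.
Proof.
move=> s0 r0 dA; rewrite /hausdorff_weight; case: ifPn => [_|/set0P[x Ax]].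
  by rewrite lee_fin powR_ge0.
rewrite -poweR_EFin; apply: gt0_ler_poweR => //.
- rewrite in_itv/= leey andbT (le_trans _ (diameter_ge Ax Ax))// lee_fin//.
- by rewrite in_itv/= leey lee_fin r0.
Qed.

Lemma hausdorff_measure_neq0 A s b M (e : nat -> nat -> nat) :
  (1 < b)%N -> (1 < M)%N -> 0 <= s -> b%:R `^ s <= M%:R :> R ->
  (forall k j, (j < M)%N -> ((e k j).+2 <= b)%N) ->
  (forall k i j, (i < M)%N -> (j < M)%N -> e k i = e k j -> i = j) ->
  (forall d, (forall k, (d k < M)%N) -> A (expansion R b (fun k => e k (d k)))) ->
  hausdorff_measure s A != 0%E.
Proof.
move=> b1 M1 s0 bsM eb einj eA; apply/eqP => H0.
have M0 : 0 < M%:R :> R by rewrite ltr0n ltnW.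
(* Pays for the two extra places in the gap: points first differing at place [k] are [b ^ -(k+2)]
   apart, while their images may be [M ^ -k] apart. *)
pose c : R := M%:R ^+ 2; have c0 : 0 < c by rewrite exprn_gt0.
have : (hausdorff_premeasure s 1 A < (4 * c)^-1%:E)%E.
  apply: (@le_lt_trans _ _ 0%E); last by rewrite lte_fin invr_gt0 mulr_gt0.
  by rewrite -H0; apply: ereal_sup_ubound; exists 1 => //=; exact: ltr01.
move=> /ereal_inf_lt[_ [U [AU dU] <-]] sumU.
pose X d := expansion R b (fun k => e k (d k)).
(* The image of [U i] when digit indices are read in base [M]; [Gdist] is the Hoelder estimate for
   this map. *)
pose G i := [set expansion R M d | d in [set d : nat -> nat |
  (forall k, (d k < M)%N) /\ U i (X d)]].
have Gdist i x y : G i x -> G i y ->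
    (`|x - y|%:E <= c%:E * hausdorff_weight s (U i))%E.
  move=> [d [dM Ud] <-] [d' [dM' Ud'] <-].
  have [eqd|/existsNP neqd] := pselect (forall k, d k = d' k).
    by rewrite (funext eqd) subrr normr0 mule_ge0 ?hausdorff_weight_ge0// lee_fin ltW.
  have ex : exists k, d k != d' k by have [k /eqP] := neqd; exists k.
  have [k neqk mink] := ex_minnP ex.
  have eqk j : (j < k)%N -> d j = d' j.
    by move=> jk; apply/eqP; apply: contraTT jk; rewrite -leqNgt => /mink.
  have gap : (b%:R ^+ k.+2)^-1 <= `|X d - X d'|.
    apply: expansion_gap => //; do ?by move=> j; exact: eb.
      by move=> j /eqk ->.
    by apply: contraNN neqk => /eqP /einj ->.
  apply: le_trans (lee_wpmul2l _ (hausdorff_weight_ge s0 Ud Ud')); last first.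
    by rewrite lee_fin ltW.
  rewrite -EFinM lee_fin (le_trans (expansion_dist R M1 dM dM' eqk))//.
  have -> : (M%:R ^+ k)^-1 = c * (M%:R ^+ k.+2)^-1.
    by rewrite (exprS _ k.+1) (exprS _ k) /c; field; rewrite !gt_eqF ?exprn_gt0.
  rewrite ler_pM2l//.
  apply: (@le_trans _ _ ((b%:R ^+ k.+2)^-1 `^ s)); last first.
    by apply: ge0_ler_powR => //; rewrite nnegrE ?invr_ge0 ?exprn_ge0.
  have b0 : 0 < b%:R :> R by rewrite ltr0n ltnW.
  have -> : (b%:R ^+ k.+2)^-1 `^ s = ((b%:R `^ s) ^+ k.+2)^-1.
    rewrite -(powR_inv1 (exprn_ge0 k.+2 (ltW b0))) -powRrM mulN1r powRN.
    by rewrite -powR_mulrn ?ler0n// -powRrM mulrC powRrM powR_mulrn ?powR_ge0.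
  rewrite lef_pV2 ?posrE ?exprn_gt0 ?powR_gt0//.
  by apply: lerXn2r => //; rewrite nnegrE ?powR_ge0.
have wfin i : hausdorff_weight s (U i) \is a fin_num.
  rewrite ge0_fin_numE ?hausdorff_weight_ge0//.
  by rewrite (le_lt_trans (hausdorff_weight_le s0 ler01 (dU i)))// ltry.
(* [J i] is an interval centred at a point of [G i], with the Hoelder bound as radius. *)
have /choice[J JP] i : exists J : set R, [/\ measurable J, G i `<=` J &
    (lebesgue_measure J <= (2 * c)%:E * hausdorff_weight s (U i))%E].
  have [G0|/set0P[z Gz]] := eqVneq (G i) set0.
    exists set0; rewrite G0; split => //.
    by rewrite measure0 mule_ge0 ?hausdorff_weight_ge0// lee_fin mulr_ge0 ?ltW.
  pose r := c * fine (hausdorff_weight s (U i)).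
  have r0 : 0 <= r by rewrite mulr_ge0 ?(ltW c0)// fine_ge0// hausdorff_weight_ge0.
  exists `[z - r, z + r]%classic; split; first exact: measurable_itv.
    move=> y Gy /=; rewrite in_itv/= -ler_distlC -lee_fin.
    by rewrite (le_trans (Gdist _ _ _ Gz Gy))// -(fineK (wfin i)) -EFinM.
  rewrite lebesgue_measure_itv/= -(fineK (wfin i)) -EFinM.
  have -> : 2 * c * fine (hausdorff_weight s (U i)) = 2 * r by rewrite /r mulrA.
  by case: ifP => _; rewrite -?EFinB lee_fin; [lra|rewrite mulr_ge0].
(* Every point of [0,1[ has a base [M] expansion, yet the lengths of the [J i] add up to less than
   [2 * c / (4 * c)], that is 1/2. *)
have cover : `[0, 1[%classic `<=` \bigcup_i J i.
  move=> x /=; rewrite in_itv/= => /(expansion_surj M1)[d dM <-].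
  have [i _ UX] := AU _ (eA d dM).
  by exists i => //; have [_ + _] := JP i; apply; exists d.
have mJ i : measurable (J i) by have [] := JP i.
have : (lebesgue_measure (`[0%R, 1%R[%classic : set R) <=
    \sum_(0 <= i <oo) lebesgue_measure (J i))%E.
  exact: (measure_sigma_subadditive lebesgue_measure mJ (measurable_itv `[0, 1[)).
rewrite lebesgue_measure_itv/= lte_fin ltr01 sube0.
apply/negP; rewrite -ltNge.
apply: (@le_lt_trans _ _ (\sum_(0 <= i <oo) ((2 * c)%:E * hausdorff_weight s (U i)))%E).
  by apply: lee_nneseries => // i _; have [] := JP i.
rewrite nneseriesZl; last by move=> i _; exact: hausdorff_weight_ge0.
apply: (@lt_trans _ _ ((2 * c)%:E * (4 * c)^-1%:E)%E).
  by rewrite lte_pmul2l ?lte_fin ?mulr_gt0.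
rewrite -EFinM lte_fin invfM mulrACA divff ?gt_eqF// mulr1; lra.
Qed.

(** * Bounds for the dimension, and the unit interval *)

Lemma hausdorff_dim_ge A s :
  (forall t, 0 <= t -> t < s -> hausdorff_measure t A != 0%E) ->
  (s%:E <= hausdorff_dim A)%E.
Proof.
move=> sA; apply: le_ereal_inf_tmp => _ [t [t0 tA] <-].
by rewrite lee_fin leNgt; apply/negP => /(sA t t0); rewrite tA eqxx.
Qed.

Lemma hausdorff_dim_le A s : 0 <= s -> hausdorff_measure s A = 0%E ->
  (hausdorff_dim A <= s%:E)%E.
Proof. by move=> s0 sA; apply: ereal_inf_lbound; exists s. Qed.

Lemma hausdorff_premeasure_ge0 s r A : (0 <= hausdorff_premeasure s r A)%E.
Proof.
apply: le_ereal_inf_tmp => _ [U _ <-].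
by apply: nneseries_ge0 => i _ _; exact: hausdorff_weight_ge0.
Qed.

Lemma hausdorff_measure_unit_itv A s : 1 < s -> A `<=` `[0, 1] ->
  hausdorff_measure s A = 0%E.
Proof.
move=> s1 A01; apply/eqP; rewrite eq_le; apply/andP; split; last first.
  apply: (le_trans (hausdorff_premeasure_ge0 s 1 A)).
  by apply: ereal_sup_ubound; exists 1 => //=; exact: ltr01.
apply: ge_ereal_sup => _ [r /= r0 <-].
apply/lee_addgt0Pr => e e0; rewrite add0e.
pose t := s - 1; have t0 : 0 < t by rewrite subr_gt0.
(* A grid of [n.+1] intervals of length [h] has total weight [n.+1 * h ^ s = h ^ t], which is at
   most [e] once [h] is below this minimum. *)
have : 0 < Num.min r (e `^ t^-1) by rewrite lt_min r0 powR_gt0.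
move=> /ltr_add_invr[n]; rewrite add0r lt_min => /andP[nr ne].
pose h : R := n.+1%:R^-1; have h0 : 0 < h by rewrite invr_gt0.
pose U i : set R := if (i < n.+1)%N then `[i%:R * h, i.+1%:R * h]%classic else set0.
have dU i : (diameter (U i) <= h%:E)%E.
  apply: ge_ereal_sup => _ [x + [y + <-]]; rewrite /U; case: ifP => // _ /=.
  rewrite !in_itv/= -natr1 mulrDl mul1r => /andP[x1 x2] /andP[y1 y2].
  by rewrite lee_fin ler_norml; apply/andP; split; lra.
apply: (@le_trans _ _ (\sum_(0 <= i <oo) hausdorff_weight s (U i))%E).
  apply: ereal_inf_lbound; exists U => //; split; last first.
    by move=> i; rewrite (le_trans (dU i))// lee_fin ltW.
  move=> x /A01 /=; rewrite in_itv/= => /andP[x0 x1].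
  (* At [x = 1] the truncation would give the index [n.+1], one past the grid; the last interval
     contains it. *)
  have [xn|xn] := ltP x 1.
    have /andP[tx xt] := truncn_itv (mulr_ge0 (ler0n R n.+1) x0).
    exists (Num.truncn (n.+1%:R * x)) => //; rewrite /U ifT /=.
      by rewrite in_itv/= ler_pdivrMr// ler_pdivlMr// (mulrC x) tx ltW.
    by rewrite truncn_lt_nat ?mulr_ge0// -[ltRHS]mulr1 ltr_pM2l.
  exists n => //; rewrite /U ltnSn /= in_itv/= /h divff// x1 andbT.
  by rewrite (le_trans _ xn)// ler_pdivrMr// mul1r ler_nat.
rewrite (nneseries_split 0 n.+1) => [|k _]; last exact: hausdorff_weight_ge0.
rewrite add0n (@eseries0 _ _ n.+1) ?adde0 => [|i ni _]; last first.
  by rewrite /U ltnNge ni /hausdorff_weight eqxx.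
apply: (@le_trans _ _ (\sum_(0 <= i < n.+1) (h `^ s)%:E)%E).
  apply: lee_sum => i _; apply: hausdorff_weight_le => //; last exact: ltW.
  by rewrite ltW// (lt_trans ltr01).
rewrite sumEFin lee_fin sumr_const_nat subn0 -mulr_natl.
have -> : h `^ s = h * h `^ t.
  by rewrite -{2}(powRr1 (ltW h0)) -powRD ?subrKC// (gt_eqF h0) implybT.
rewrite mulrA divff// mul1r.
have -> : e = (e `^ t^-1) `^ t by rewrite -powRrM mulVf ?powRr1 ?gt_eqF// ltW.
by apply: ge0_ler_powR; rewrite ?nnegrE ?powR_ge0// ltW.
Qed.

End Hausdorff.

(** * Level sets over balanced expansions *)

Section LevelSets.
Variable R : realType.

(** The top digit is all ones, hence of slope [- N]. Balanced digits avoid it, as [expansion_gap]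
    requires. *)
Lemma balanced_bound N B : (0 < N)%N -> (B < 2 ^ N)%N -> slope N B = 0 ->
  (B.+2 <= 2 ^ N)%N.
Proof.
move=> N0 ltB sB; rewrite ltn_neqAle ltB andbT; apply/eqP => eB.
by have := slope_compl ltB; rewrite eB subnn slope_zero sB; lia.
Qed.

(** Reflection turns the complement of [B] into [B.+1], and a zero slope makes the step from [B] to
    [B.+1] flat. *)
Lemma balanced_compl N B : (B < 2 ^ N)%N -> slope N B = 0 ->
  [/\ (2 ^ N - B.+1 < 2 ^ N)%N, slope N (2 ^ N - B.+1) = 0 &
      tak N (2 ^ N - B.+1) = tak N B].
Proof.
move=> ltB sB; split; first by lia.
  by rewrite slope_compl// sB oppr0.
by rewrite tak_sym//; have := tak_succ ltB; rewrite sB; lia.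
Qed.

Lemma hausdorff_dim_level_set N (u : nat -> nat) : (0 < N)%N ->
  (forall k, (u k < 2 ^ N)%N) -> (forall k, slope N (u k) = 0) ->
  (0 < hausdorff_dim (takagi_level_set (expansion R (2 ^ N) (tak N \o u))))%E.
Proof.
move=> N0 ub us.
have b1 : (1 < 2 ^ N)%N by rewrite -[1%N](expn0 2) ltn_exp2l.
apply: (@lt_le_trans _ _ (N%:R^-1)%:E); first by rewrite lte_fin invr_gt0 ltr0n.
apply: hausdorff_dim_ge => t t0 tN.
(* Two choices per place in base [2 ^ N] give dimension at least 1/N. *)
pose e k j := if j == 0%N then u k else (2 ^ N - (u k).+1)%N.
have eP k j : [/\ (e k j < 2 ^ N)%N, slope N (e k j) = 0 & tak N (e k j) = tak N (u k)].
  by rewrite /e; case: ifP => // _; exact: balanced_compl.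
apply: (@hausdorff_measure_neq0 _ _ _ (2 ^ N) 2 e) => //.
- apply: (@le_trans _ _ ((2 ^ N)%:R `^ N%:R^-1)).
    by apply: ler_powR; [rewrite ler1n ltnW|exact: ltW].
  by rewrite natrX -powR_mulrn// -powRrM divff ?powRr1// pnatr_eq0 -lt0n.
- by move=> k j _; have [] := eP k j => *; exact: balanced_bound.
(* A digit and its complement sum to the odd number [2 ^ N - 1], so they differ. *)
- move=> k; have := ub k; have : odd (2 ^ N) = false by rewrite oddX orbF; exact: gtn_eqF.
  by move=> o ltu [|[|i]] [|[|j]]//; rewrite /e /=; lia.
- move=> d _; split.
    by apply: expansion_itv => // k; have [] := eP k (d k).
  rewrite takagi_expansion//; do ?by move=> k; have [] := eP k (d k).
  by congr expansion; apply/funext => k /=; have [] := eP k (d k).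
Qed.

Lemma expansion_tak_le m (u : nat -> nat) : (0 < m)%N ->
  (forall k, (u k < 2 ^ m.*2)%N) ->
  0 <= expansion R (2 ^ m.*2) (tak m.*2 \o u) <= 2 / 3.
Proof.
move=> m0 ub.
have b1 : (1 < 2 ^ m.*2)%N by rewrite -[1%N](expn0 2) ltn_exp2l// double_gt0.
(* The largest digit that [tak_le] permits; the constant expansion with digit [q] is at most 2/3. *)
pose q := ((2 * 2 ^ m.*2 - 2) %/ 3)%N.
have uq k : ((tak m.*2 \o u) k <= q)%N.
  by rewrite /q leq_divRL//=; have := tak_le (ub k); lia.
have := expansion_ge R b1 0 uq; have := expansion_le R b1 0 uq.
rewrite /digit_series seriesEnat /= big_nil add0r expr0 divr1 => le ->.
apply: (le_trans le); rewrite ler_pdivrMr ?subr_gt0 ?ltr1n//.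
have : (3 * q <= 2 * 2 ^ m.*2 - 2)%N by rewrite mulnC leq_divM.
rewrite -(ler_nat R) natrM natrB ?natrM; last by lia.
by lra.
Qed.

Lemma hausdorff_dim_Gamma_ge k : (2 < k)%N ->
  ((1 - 2 / k%:R)%:E <= hausdorff_dim (@Gamma_H_ord R))%E.
Proof.
move=> k2; have [m [s [m0 mk sB us ms]]] := many_balanced_pow2 k2.
have N0 : (0 < m.*2)%N by rewrite double_gt0.
have b1 : (1 < 2 ^ m.*2)%N by rewrite -[1%N](expn0 2) ltn_exp2l.
have k0 : 0 < k%:R :> R by rewrite ltr0n; lia.
have kk : (12 * k ^ 2 + 24 * k < 12 * k ^ 3)%N by rewrite !expnS expn0; nia.
apply: hausdorff_dim_ge => t t0 tk.
have sP j : (j < size s)%N -> (nth 0%N s j < 2 ^ m.*2)%N /\ slope m.*2 (nth 0%N s j) = 0.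
  by move=> js; apply: sB; exact: mem_nth.
apply: (@hausdorff_measure_neq0 _ _ _ (2 ^ m.*2) (size s)
  (fun _ j => tak m.*2 (nth 0%N s j))) => //.
- by rewrite (leq_trans _ ms)// -[1%N](expn0 2) ltn_exp2l// subn_gt0.
- apply: (@le_trans _ _ ((2 ^ m.*2)%:R `^ (1 - 2 / k%:R))).
    by apply: ler_powR; [rewrite ler1n ltnW|exact: ltW].
  apply: (@le_trans _ _ (2 ^ (12 * k ^ 3 - (12 * k ^ 2 + 24 * k)))%:R);
    last by rewrite ler_nat.
  rewrite natrX -powR_mulrn// -powRrM natrX -powR_mulrn//.
  apply: ler_powR; first by rewrite ler1n.
  (* This product equals [12 * k ^ 3 - (12 * k ^ 2 + 24 * k)] exactly, which explains the exponent
     in [many_balanced_pow2]. *)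
  apply: (@le_trans _ _ ((12 * k ^ 3 + 12 * k ^ 2)%:R * (1 - 2 / k%:R))).
    rewrite ler_wpM2r ?ler_nat//; lra.
  rewrite natrB ?(ltnW kk)// !natrD !natrM ?natrX le_eqVlt; apply/orP; left.
  by apply/eqP; field; rewrite gt_eqF.
- move=> _ j js; have [ltj _] := sP j js; have := tak_le ltj; lia.
- move=> _ i j si sj /eqP.
  rewrite -!(nth_map _ 0%N (tak m.*2))// => /eqP eij; apply/eqP.
  by rewrite -(nth_uniq 0%N _ _ us) ?size_map// eij.
- move=> d ds; have ub k' : (nth 0%N s (d k') < 2 ^ m.*2)%N by have [] := sP _ (ds k').
  split; first exact: (@expansion_tak_le _ (fun k => nth 0%N s (d k))).
  apply: (@hausdorff_dim_level_set _ (fun k => nth 0%N s (d k))) => // k'.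
  by have [] := sP _ (ds k').
Qed.

End LevelSets.

Theorem theorem1p5 (R : realType) : hausdorff_dim (@Gamma_H_ord R) = 1%E.
Proof.
apply/eqP; rewrite eq_le; apply/andP; split.
  apply/lee_addgt0Pr => e e0; rewrite -EFinD.
  apply: hausdorff_dim_le; first by rewrite addr_ge0// ltW.
  apply: hausdorff_measure_unit_itv; first by rewrite ltrDl.
  by move=> y [/andP[y0 y1] _] /=; rewrite in_itv/= y0; lra.
apply/lee_subgt0Pr => e e0.
have e30 : 0 < e / 3 by rewrite divr_gt0.
have [n] := ltr_add_invr e30; rewrite add0r => ne.
(* The shift to [n.+3] secures [2 < k]; then [2 / k] is below [2 * e / 3]. *)
apply: le_trans (hausdorff_dim_Gamma_ge R (isT : (2 < n.+3)%N)).
rewrite -EFinB lee_fin lerB//.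
have : n.+3%:R^-1 <= n.+1%:R^-1 :> R by rewrite lef_pV2 ?posrE// ler_nat; lia.
by move: ne; set x := n.+1%:R^-1; set y := n.+3%:R^-1; lra.
Qed.
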